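(* Let $u=u_1\cdots u_r$ be an allowed prime word of $\Sigma_A$ with $r\ge2$. If $w=w_1\cdots w_r\in\mathcal L_r$ satisfies $w_1=u_1$, $w_r=u_r$ and $\delta_w=\delta_u$, then $\rho(C_w)\le\rho(C_u)$. Moreover, if $1$ is the only positive real eigenvalue of $P$, then $\rho(C_w)=\rho(C_u)$ if and only if $w$ is a prime word.
   Context: Let $\Sigma=\{1,\dots,N\}$, $A$ an irreducible $N\times N$ $0$–$1$ matrix, $\Sigma_A=\{x\in\Sigma^{\mathbb N}:A_{x_nx_{n+1}}=1\ \forall n\}$ with left shift $\sigma$; $\mathcal L_r$ is the set of allowed words of length $r$ (occurring in some element of $\Sigma_A$); $C_u$ is the set of $x\in\Sigma_A$ beginning with $u$. $P$ is a row-stochastic matrix with $P_{ij}>0$ iff $A_{ij}=1$, $\mathbf p$ its stationary vector, $\mu=\mu_P$ the Markov measure $\mu(C_v)=p_{v_1}P_{v_1v_2}\cdots P_{v_{n-1}v_n}$. For a hole $H$, $\mathcal W_m=\{x:\sigma^ix\notin H,0\le i\le m\}$ and $\rho(H)=-\lim_m\frac1m\ln\mu(\mathcal W_m)$. For a word $v=v_1\cdots v_r$, $\delta_v=P_{v_1v_2}\cdots P_{v_{r-1}v_r}$. A word $v=v_1\cdots v_r$ is prime if for $0\le s\le r-1$ the equality $v_{s+1}\cdots v_r=v_1\cdots v_{r-s}$ holds only for $s=0$. *)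

(* Defs.v *)
From HB Require Import structures.
From mathcomp Require Import all_boot all_order all_algebra.
From mathcomp Require Import all_classical all_reals all_analysis.
Set Implicit Arguments. Unset Strict Implicit. Unset Printing Implicit Defensive.
Import Order.TTheory GRing.Theory Num.Theory numFieldNormedType.Exports.
Local Open Scope ring_scope.

(* Alphabet Sigma = 'I_N; transition 0-1 matrix A given as a boolean relation. *)

Definition irreducible_mx (N : nat) (A : 'I_N -> 'I_N -> bool) : Prop :=
  forall i j : 'I_N, exists k, A i k && connect (fun a b => A a b) k j.

Definition in_SigmaA (N : nat) (A : 'I_N -> 'I_N -> bool) (x : nat -> 'I_N) : Prop :=
  forall n, A (x n) (x n.+1).

Definition allowed_word (N : nat) (A : 'I_N -> 'I_N -> bool) (v : seq 'I_N) : Prop :=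
  exists x : nat -> 'I_N, in_SigmaA A x /\
    exists k, mkseq (fun i => x (k + i)%N) (size v) = v.

Definition compatible_stochastic (R : realType) (N : nat)
    (A : 'I_N -> 'I_N -> bool) (P : 'M[R]_N) : Prop :=
  (forall i j, 0 <= P i j) /\ (forall i, \sum_j P i j = 1) /\
  (forall i j, (0 < P i j) = A i j).

Definition stationary_vector (R : realType) (N : nat) (P : 'M[R]_N) (p : 'rV[R]_N) : Prop :=
  (forall i, 0 <= p 0 i) /\ \sum_i p 0 i = 1 /\ p *m P = p.

Definition prime_word (T : eqType) (v : seq T) : Prop :=
  forall s, (0 < s < size v)%N -> drop s v <> take (size v - s) v.

Definition delta (R : realType) (N : nat) (P : 'M[R]_N) (v : seq 'I_N) : R :=
  \prod_(ab <- zip v (behead v)) P ab.1 ab.2.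

Definition mu_cyl (R : realType) (N : nat) (P : 'M[R]_N) (p : 'rV[R]_N) (v : seq 'I_N) : R :=
  match v with
  | [::] => 1
  | a :: _ => p 0 a * delta P v
  end.

(* mu(W_m) for the hole H = C_w : W_m = {x | sigma^i x notin C_w, 0 <= i <= m}
   is the finite union of the cylinders C_t, t of length m + |w|, such that w
   does not occur in t at any position i <= m. *)
Definition mu_W (R : realType) (N : nat) (P : 'M[R]_N) (p : 'rV[R]_N)
    (w : seq 'I_N) (m : nat) : R :=
  \sum_(t : (m + size w).-tuple 'I_N |
          [forall i : 'I_m.+1, take (size w) (drop i t) != w]) mu_cyl P p t.

Definition rho (R : realType) (N : nat) (P : 'M[R]_N) (p : 'rV[R]_N) (w : seq 'I_N) : R :=
  - limn (fun m : nat => ln (mu_W P p w m) / m%:R).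

(* Main.v *)
Require Import Defs.
From HB Require Import structures.
From mathcomp Require Import all_boot all_order all_algebra.
From mathcomp Require Import all_classical all_reals all_analysis.
From mathcomp Require Import ring lra zify.
Set Implicit Arguments. Unset Strict Implicit. Unset Printing Implicit Defensive.
Import Order.TTheory GRing.Theory Num.Theory numFieldNormedType.Exports.
Local Open Scope ring_scope.

(** Let [a] and [b] be the first and last letters of [u] and [w], and let [U] and
[V] be the generating series of the probabilities that the chain started at [b]
avoids [u], respectively [w], for [n] steps. Decomposing trajectories at the
first occurrence of the word relates these series to the laws [F_u], [F_w] of the
first occurrences and to the weighted autocorrelation series [Psi_u], [Psi_w] by
[Psi_u F_u V = Psi_w F_w U], where [F_w = 1 - (1 - X) V]. A prime word has
[Psi = 1], hence [V = U + (Psi_w - 1) F_w U], so that [U <= V] coefficientwise,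
with equality when [w] is prime too. Started from the stationary vector, the
avoidance probability drops at each step by the probability of seeing the word
at the start only; since it decays geometrically, it is comparable with [U], and
the escape rate, which exists by Fekete's lemma, is the decay rate of [U]. If
[Psi_w <> 1], then [V >= phi X^k F_w U] with [phi, k > 0]; evaluating at
[1 < x < e^(-L)], with [L] the growth rate of [V], where
[F_w(x) > (x - 1) V(x)], yields [phi (x - 1) U(x) < 1]. So [U] stays bounded up
to [e^(-L)] and its growth rate is smaller than [L]. *)

(** * Formal power series *)

Definition fps (R : comNzRingType) : Type := nat -> R.

Section FormalPowerSeries.
Variable R : comNzRingType.
Implicit Types f g h : fps R.

HB.instance Definition _ := GRing.Zmodule.copy (fps R) (nat -> R).

Definition fps_one : fps R := fun n => (n == 0%N)%:R.
Definition fps_mul f g : fps R := fun n => \sum_(i < n.+1) f i * g (n - i)%N.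

Let trunc f n : {poly R} := \poly_(i < n.+1) f i.

Let coef_trunc f n i : (i <= n)%N -> (trunc f n)`_i = f i.
Proof. by rewrite coef_poly ltnS => ->. Qed.

Let fps_mulE f g m n : (n <= m)%N ->
  fps_mul f g n = (trunc f m * trunc g m)`_n.
Proof.
move=> nm; rewrite coefM; apply: eq_bigr => i _.
have im := ltn_ord i; rewrite !coef_trunc //; lia.
Qed.

Let eq_coefM (p q p' q' : {poly R}) n :
  (forall i, (i <= n)%N -> p`_i = p'`_i) ->
  (forall i, (i <= n)%N -> q`_i = q'`_i) -> (p * q)`_n = (p' * q')`_n.
Proof.
move=> pp' qq'; rewrite !coefM; apply: eq_bigr => i _.
have im := ltn_ord i; rewrite pp' ?qq' //; lia.
Qed.

Fact fps_mulA : associative fps_mul.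
Proof.
move=> f g h; apply/funext => n; rewrite !(fps_mulE _ _ (leqnn n)).
transitivity ((trunc f n * (trunc g n * trunc h n))`_n).
  by apply: eq_coefM => i ile //; rewrite coef_trunc //; apply: fps_mulE.
rewrite mulrA; apply: eq_coefM => i ile //; rewrite coef_trunc //.
by rewrite -fps_mulE.
Qed.

Fact fps_mulC : commutative fps_mul.
Proof. by move=> f g; apply/funext => n; rewrite !(fps_mulE _ _ (leqnn n)) mulrC. Qed.

Fact fps_mul1 : left_id fps_one fps_mul.
Proof.
move=> f; apply/funext => n; rewrite /fps_mul big_ord_recl /= subn0 mul1r.
by rewrite big1 ?addr0 // => i _; rewrite /fps_one /= mul0r.
Qed.

Fact fps_mulDl : left_distributive fps_mul +%R.
Proof.
move=> f g h; apply/funext => n.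
rewrite -[RHS]/(fps_mul f h n + fps_mul g h n) /fps_mul -big_split /=.
by apply: eq_bigr => i _; rewrite mulrDl.
Qed.

Fact fps_one_neq0 : fps_one != 0.
Proof. by apply/eqP => /(congr1 (fun f => f 0%N)) /eqP; rewrite oner_eq0. Qed.

HB.instance Definition _ := GRing.Zmodule_isComNzRing.Build (fps R)
  fps_mulA fps_mulC fps_mul1 fps_mulDl fps_one_neq0.

Definition fpsX : fps R := fun n => (n == 1%N)%:R.

Lemma fpsDE f g n : (f + g) n = f n + g n. Proof. by []. Qed.
Lemma fpsBE f g n : (f - g) n = f n - g n. Proof. by []. Qed.
Lemma fps1E n : (1 : fps R) n = (n == 0%N)%:R. Proof. by []. Qed.
Lemma fpsME f g n : (f * g) n = \sum_(i < n.+1) f i * g (n - i)%N.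
Proof. by []. Qed.

Lemma fpsXM0 f : (fpsX * f) 0%N = 0.
Proof. by rewrite fpsME big_ord1 mul0r. Qed.

Lemma fpsXMS f n : (fpsX * f) n.+1 = f n.
Proof.
rewrite fpsME big_ord_recl mul0r add0r big_ord_recl /= mul1r subn1 /=.
by rewrite big1 ?addr0 // => i _; rewrite mul0r.
Qed.

Lemma fps_sub1XM0 f : ((1 - fpsX) * f) 0%N = f 0%N.
Proof. by rewrite mulrBl mul1r fpsBE fpsXM0 subr0. Qed.

Lemma fps_sub1XMS f n : ((1 - fpsX) * f) n.+1 = f n.+1 - f n.
Proof. by rewrite mulrBl mul1r fpsBE fpsXMS. Qed.

End FormalPowerSeries.

Section NonnegativeSeries.
Variable R : numDomainType.
Implicit Types f g : fps R.

Lemma fpsM_ge f g m n : (forall k, 0 <= f k) -> (forall k, 0 <= g k) ->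
  f m * g n <= (f * g) (m + n)%N.
Proof.
move=> f_ge0 g_ge0; rewrite fpsME.
have mP : (m < (m + n).+1)%N by rewrite ltnS leq_addr.
rewrite (bigD1 (Ordinal mP)) //= addKn lerDl.
by apply: sumr_ge0 => i _; rewrite mulr_ge0.
Qed.

Lemma fpsM_ge0 f g n : (forall k, 0 <= f k) -> (forall k, 0 <= g k) ->
  0 <= (f * g) n.
Proof. by move=> f_ge0 g_ge0; apply: sumr_ge0 => i _; rewrite mulr_ge0. Qed.

End NonnegativeSeries.

(** * Expectations over finite trajectories *)

Section PathExpectation.
Variables (R : comNzRingType) (N : nat) (P : 'M[R]_N).
Implicit Types (n k : nat) (i j : 'I_N) (t : seq 'I_N) (h : seq 'I_N -> R).

(* The expectation of [h t], with [t] the first [n + 1] letters of the Markov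
   chain started at [i]. *)
Fixpoint Epath n i h : R :=
  if n is m.+1 then \sum_j P i j * Epath m j (fun t => h (i :: t))
  else h [:: i].

Lemma eq_Epath n i h h' : (forall t, size t = n -> h (i :: t) = h' (i :: t)) ->
  Epath n i h = Epath n i h'.
Proof.
elim: n i h h' => [|n IHn] i h h' hh' /=; first exact: hh'.
apply: eq_bigr => j _; congr (_ * _); apply: IHn => t st.
by apply: hh' => /=; rewrite st.
Qed.

Lemma EpathD n i h h' :
  Epath n i (fun t => h t + h' t) = Epath n i h + Epath n i h'.
Proof.
elim: n i h h' => [|n IHn] i h h' //=.
by rewrite -big_split; apply: eq_bigr => j _; rewrite /= IHn mulrDr.
Qed.

Lemma EpathZ n i c h : Epath n i (fun t => c * h t) = c * Epath n i h.
Proof.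
elim: n i h => [|n IHn] i h //=.
by rewrite mulr_sumr; apply: eq_bigr => j _; rewrite IHn mulrCA.
Qed.

Lemma EpathZr n i c h : Epath n i (fun t => h t * c) = Epath n i h * c.
Proof. by rewrite mulrC -EpathZ; apply: eq_Epath => t _; rewrite mulrC. Qed.

Lemma Epath0 n i : Epath n i (fun=> 0) = 0.
Proof.
rewrite -[RHS](mul0r (Epath n i (fun=> 0))) -EpathZ.
by apply: eq_Epath => t _; rewrite mul0r.
Qed.

Lemma EpathB n i h h' :
  Epath n i (fun t => h t - h' t) = Epath n i h - Epath n i h'.
Proof.
rewrite -[in RHS]mulN1r -EpathZ -EpathD.
by apply: eq_Epath => t _; rewrite mulN1r.
Qed.

Lemma Epath_sum n i m (F : 'I_m -> seq 'I_N -> R) :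
  Epath n i (fun t => \sum_k F k t) = \sum_k Epath n i (F k).
Proof.
elim: m F => [|m IHm] F.
  by rewrite big_ord0 -[RHS](Epath0 n i); apply: eq_Epath => t _; rewrite big_ord0.
rewrite big_ord_recr -IHm /= -EpathD.
by apply: eq_Epath => t _; rewrite big_ord_recr.
Qed.

Lemma Epath_cat n k i h : Epath (n + k) i h =
  Epath n i (fun t => Epath k (last i t) (fun t' => h (t ++ behead t'))).
Proof.
elim: n i h => [|n IHn] i h /=; first by case: k.
by apply: eq_bigr => j _; rewrite IHn; congr (_ * _); apply: eq_Epath.
Qed.

Hypothesis P_sum1 : forall i, \sum_j P i j = 1.

Lemma Epath_cst n i c : Epath n i (fun=> c) = c.
Proof.
elim: n i => [|n IHn] i //=.
by under eq_bigr do rewrite IHn; rewrite -mulr_suml P_sum1 mul1r.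
Qed.

Lemma Epath_take n k i h :
  Epath (n + k) i (fun t => h (take n.+1 t)) = Epath n i h.
Proof.
rewrite Epath_cat; apply: eq_Epath => t st.
rewrite -[RHS](Epath_cst k (last i (i :: t))).
by apply: eq_Epath => t' _; rewrite take_size_cat //= st.
Qed.

End PathExpectation.

Section PathExpectationOrder.
Variables (R : numDomainType) (N : nat) (P : 'M[R]_N).
Hypothesis P_ge0 : forall i j, 0 <= P i j.
Implicit Types (n : nat) (i : 'I_N) (h : seq 'I_N -> R).

Lemma le_Epath n i h h' :
  (forall t, size t = n -> h (i :: t) <= h' (i :: t)) ->
  Epath P n i h <= Epath P n i h'.
Proof.
elim: n i h h' => [|n IHn] i h h' hh' /=; first exact: hh'.
apply: ler_sum => j _; apply: ler_wpM2l => //.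
by apply: IHn => t st; apply: hh' => /=; rewrite st.
Qed.

Lemma Epath_ge0 n i h : (forall t, 0 <= h t) -> 0 <= Epath P n i h.
Proof. by move=> h_ge0; rewrite -(Epath0 P n i); apply: le_Epath. Qed.

End PathExpectationOrder.

Section PathExpectationDelta.
Variables (R : realType) (N : nat) (P : 'M[R]_N).
Implicit Types (i j : 'I_N) (t : seq 'I_N) (h : seq 'I_N -> R).

Lemma delta1 i : delta P [:: i] = 1.
Proof. by rewrite /delta big_nil. Qed.

Lemma delta_cons i j t : delta P [:: i, j & t] = P i j * delta P (j :: t).
Proof. by rewrite /delta big_cons. Qed.

Lemma Epath_pred1 i a s :
  Epath P (size s) i (fun t => (t == a :: s)%:R) = (i == a)%:R * delta P (a :: s).
Proof.
elim: s i a => [|c s IHs] i a /=; first by rewrite delta1 mulr1 eqseq_cons andbT.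
under eq_bigr => j _.
  under eq_fun do rewrite eqseq_cons -mulnb natrM.
  rewrite EpathZ IHs mulrCA [in X in _ * X]mulrCA.
  over.
rewrite -mulr_sumr delta_cons (bigD1 c) //= eqxx mul1r big1 ?addr0.
  by case: eqP => [->|]; rewrite ?mul0r.
by move=> j /negPf ->; rewrite mul0r.
Qed.

Lemma Epath_ge_delta i t h : (forall i j, 0 <= P i j) -> (forall t, 0 <= h t) ->
  delta P (i :: t) * h (i :: t) <= Epath P (size t) i h.
Proof.
move=> P_ge0; elim: t i h => [|j t IHt] i h h_ge0 /=.
  by rewrite delta1 mul1r.
rewrite delta_cons (bigD1 j) //= -mulrA ler_wpDr //.
  by apply: sumr_ge0 => l _; rewrite mulr_ge0 // Epath_ge0.
by apply: ler_wpM2l => //; apply: (IHt j (fun t => h (i :: t))).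
Qed.

End PathExpectationDelta.

(** * The renewal equation for occurrences of a word *)

Lemma suffix_catr_long (T : eqType) (w s t : seq T) : (size w <= size t)%N ->
  suffix w (s ++ t) = suffix w t.
Proof.
move=> wt; rewrite !suffixE size_cat drop_cat ltnNge.
rewrite (_ : (size s <= size s + size t - size w)%N) /=; last by lia.
by congr (drop _ _ == _); lia.
Qed.

Definition first_occurs_at (T : eqType) (w : seq T) k (t : seq T) : bool :=
  infix w (take k.+1 t) && ~~ infix w (take k t).

Section FirstOccurrence.
Variables (T : eqType) (w : seq T).
Implicit Types (t : seq T) (k : nat).

Lemma first_occurs_at_take k t :
  first_occurs_at w k (take k.+1 t) = first_occurs_at w k t.
Proof. by rewrite /first_occurs_at !take_takel. Qed.

Lemma natr_first_occurs_at (R : comNzRingType) k t :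
  (first_occurs_at w k t)%:R =
  (infix w (take k.+1 t))%:R - (infix w (take k t))%:R :> R.
Proof.
have : infix w (take k t) -> infix w (take k.+1 t).
  move=> wt; apply: infix_trans wt _.
  by rewrite -(take_takel t (leqnSn k)) infix_take.
rewrite /first_occurs_at; case: (infix w (take k t)) => [/(_ isT) ->|_].
  by rewrite subrr.
by rewrite andbT subr0.
Qed.

Lemma sum_first_occurs_at (R : comNzRingType) n t : w != [::] -> size t = n ->
  \sum_(k < n) (first_occurs_at w k t)%:R = (infix w t)%:R :> R.
Proof.
move=> w_neq0 st; under eq_bigr do rewrite natr_first_occurs_at.
rewrite -(big_mkord xpredT
  (fun k => (infix w (take k.+1 t))%:R - (infix w (take k t))%:R)).
rewrite telescope_sumr // take0 infixs0 (negPf w_neq0) subr0.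
by rewrite take_oversize ?st.
Qed.

Lemma first_occurs_at_suffix k t :
  (k < size t)%N -> first_occurs_at w k t -> suffix w (take k.+1 t).
Proof.
case: t => [//|x t] kt; rewrite /first_occurs_at (take_nth x) //.
by rewrite infix_rconsl andb_orl andbN orbF => /andP[].
Qed.

End FirstOccurrence.

Section Renewal.
Variables (R : comNzRingType) (N : nat) (P : 'M[R]_N).
Implicit Types (i j : 'I_N) (t w : seq 'I_N) (n k : nat).

Definition avoidance w i : fps R :=
  fun n => Epath P n i (fun t => (~~ infix w t)%:R).

Definition occurrence w i : fps R :=
  fun n => Epath P n i (fun t => (suffix w t)%:R).

Definition first_occurrence w i : fps R :=
  fun n => Epath P n i (fun t => (first_occurs_at w n t)%:R).

(* The occurrences of the word [a :: s] in a trajectory that has just completed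
   one, hence stands at [last a s]; the given one counts at time [0]. *)
Definition reoccurrence (a : 'I_N) (s : seq 'I_N) : fps R :=
  fun n => Epath P n (last a s) (fun t => (suffix (a :: s) ((a :: s) ++ behead t))%:R).

(* The Guibas-Odlyzko autocorrelation, each overlap being weighted by the
   probability of completing it. *)
Definition autocorrelation a s : fps R :=
  reoccurrence a s - occurrence (a :: s) (last a s).

Lemma occurrence_short w i n : (n.+1 < size w)%N -> occurrence w i n = 0.
Proof.
move=> nw; rewrite -[RHS](Epath0 P n i); apply: eq_Epath => t st.
case: (boolP (suffix w _)) => // /suffixW/size_infix /=; rewrite st; lia.
Qed.

Hypothesis P_sum1 : forall i, \sum_j P i j = 1.

Lemma first_occurrenceE w i : w != [::] ->
  first_occurrence w i = 1 - (1 - fpsX R) * avoidance w i.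
Proof.
move=> w_neq0; apply/funext => -[|n]; rewrite fpsBE fps1E.
  rewrite fps_sub1XM0; transitivity ((infix w [:: i])%:R : R).
    by rewrite /first_occurrence [LHS]/= /first_occurs_at take0 infixs0 w_neq0 andbT.
  rewrite -[avoidance w i 0%N]/((~~ infix w [:: i])%:R).
  by case: (infix w [:: i]); rewrite ?subr0 ?subrr.
rewrite fps_sub1XMS sub0r opprB /avoidance -(Epath_take P_sum1 n 1) addn1 -EpathB.
apply: eq_Epath => t st; rewrite natr_first_occurs_at.
rewrite [X in infix w X]take_oversize; last by rewrite /= st.
by case: (infix w (i :: t)); case: (infix w (take _ _)); rewrite ?subrr.
Qed.

Section Word.
Variables (a : 'I_N) (s : seq 'I_N).
Local Notation w := (a :: s).
Local Notation b := (last a s).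

(* A trajectory that has completed [w] for the first time stands at [b], and
   only the last [size w] letters matter for the later occurrences. *)
Lemma Epath_first_occurs_at i k n :
  Epath P (k + n) i (fun t => (first_occurs_at w k t)%:R * (suffix w t)%:R) =
  first_occurrence w i k * reoccurrence a s n.
Proof.
rewrite Epath_cat -EpathZr; apply: eq_Epath => t st.
have t_take t' : take k.+1 ((i :: t) ++ t') = i :: t by rewrite take_size_cat //= st.
transitivity ((first_occurs_at w k (i :: t))%:R *
    Epath P n (last i t) (fun t' => (suffix w ((i :: t) ++ behead t'))%:R)).
  rewrite -EpathZ; apply: eq_Epath => t' _.
  by rewrite -first_occurs_at_take t_take.
case: (boolP (first_occurs_at w k (i :: t))) => [wt|]; last by rewrite !mul0r.
have /suffixP[r tE] : suffix w (i :: t).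
  have := first_occurs_at_suffix _ wt.
  by rewrite -{2}[i :: t]cats0 t_take; apply; rewrite [size _]/= st.
congr (_ * _); rewrite -[last i t]/(last i (i :: t)) tE.
rewrite last_cat; apply: eq_Epath => t' _.
by rewrite -catA (suffix_catr_long r) // size_cat leq_addr.
Qed.

Lemma renewal i : first_occurrence w i * reoccurrence a s = occurrence w i.
Proof.
apply/funext => n; rewrite fpsME.
transitivity (Epath P n i
    (fun t => \sum_(k < n.+1) (first_occurs_at w k t)%:R * (suffix w t)%:R)).
  rewrite Epath_sum; apply: eq_bigr => k _.
  by rewrite -Epath_first_occurs_at subnKC // -ltnS.
apply: eq_Epath => t st; rewrite -mulr_suml sum_first_occurs_at ?[size _]/= ?st //.
by case: (boolP (suffix w (i :: t))) => [/suffixW ->|]; rewrite ?mulr1 ?mulr0.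
Qed.

Lemma reoccurrence_long n : (size s <= n)%N -> reoccurrence a s n = occurrence w b n.
Proof.
move=> sn; apply: eq_Epath => t st; rewrite [behead _]/= lastI cat_rcons -lastI.
by rewrite suffix_catr_long //= st.
Qed.

Lemma autocorrelationE n :
  autocorrelation a s n = if (n < size s)%N then reoccurrence a s n else 0.
Proof.
rewrite /autocorrelation fpsBE; case: ltnP => sn.
  by rewrite occurrence_short ?subr0.
by rewrite reoccurrence_long ?subrr.
Qed.

Lemma first_occurrence_autocorrelation :
  first_occurrence w b * autocorrelation a s =
  occurrence w b * (1 - fpsX R) * avoidance w b.
Proof.
have := renewal b; rewrite /autocorrelation mulrBr => ->.
by rewrite first_occurrenceE //; ring.
Qed.

Lemma autocorrelation0 : (0 < size s)%N -> autocorrelation a s 0%N = 1.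
Proof.
by move=> s_gt0; rewrite autocorrelationE s_gt0 /reoccurrence /= cats0 suffix_refl.
Qed.

Lemma autocorrelation_prime : (0 < size s)%N -> prime_word w ->
  autocorrelation a s = 1.
Proof.
move=> s_gt0 wP; apply/funext => -[|n]; rewrite fps1E; first exact: autocorrelation0.
rewrite autocorrelationE; case: ltnP => // ns.
rewrite -[RHS](Epath0 P n.+1 b); apply: eq_Epath => t st.
case: (boolP (suffix _ _)) => //; rewrite suffixE size_cat [behead _]/= st addKn.
rewrite drop_cat ifT; last by rewrite /= ltnS ltnW.
move=> /eqP w_eq; have n_lt : (0 < n.+1 < size w)%N by rewrite /= ltnS ltnW.
by case: (wP _ n_lt); rewrite -{3}w_eq take_size_cat // size_drop.
Qed.

End Word.

End Renewal.

(** * Avoidance probabilities *)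

Section Avoidance.
Variables (R : numDomainType) (N : nat) (P : 'M[R]_N) (w : seq 'I_N).
Hypothesis P_ge0 : forall i j, 0 <= P i j.
Implicit Types (i j : 'I_N) (n k : nat).

Lemma avoidance_ge0 i n : 0 <= avoidance P w i n.
Proof. exact: Epath_ge0. Qed.

Lemma first_occurrence_ge0 i n : 0 <= first_occurrence P w i n.
Proof. exact: Epath_ge0. Qed.

Lemma autocorrelation_ge0 (a : 'I_N) s n : 0 <= autocorrelation P a s n.
Proof. by rewrite autocorrelationE; case: ifP => // _; apply: Epath_ge0. Qed.

Lemma avoidance_cat i n k c : (forall j, avoidance P w j k <= c) ->
  avoidance P w i (n + k) <= avoidance P w i n * c.
Proof.
move=> k_le; rewrite /avoidance Epath_cat -EpathZr; apply: le_Epath => // t _.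
have cat_last t' : (i :: t) ++ t' = belast i t ++ last i t :: t'.
  by rewrite -cat_rcons -lastI.
case: (boolP (infix w (i :: t))) => it; rewrite ?mul0r ?mul1r.
  rewrite -(Epath0 P k (last i t)); apply: le_Epath => // t' _.
  by rewrite infix_catr.
apply: le_trans (k_le (last i t)); apply: le_Epath => // t' _.
rewrite cat_last ler_nat; case: (boolP (infix w (last i t :: t'))) => [wt|_].
  by rewrite infix_catl.
exact: leq_b1.
Qed.

Hypothesis P_sum1 : forall i, \sum_j P i j = 1.

Lemma avoidance_le1 i n : avoidance P w i n <= 1.
Proof.
rewrite -[leRHS](Epath_cst P_sum1 n i); apply: le_Epath => // t _.
by rewrite lern1 leq_b1.
Qed.

Lemma avoidance_nincr i : {homo avoidance P w i : m n / (m <= n)%N >-> n <= m}.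
Proof.
move=> m n mn; rewrite -(subnKC mn) -[leRHS]mulr1; apply: avoidance_cat => j.
exact: avoidance_le1.
Qed.

Variable p : 'rV[R]_N.
Hypothesis p_ge0 : forall i, 0 <= p 0 i.

Definition mean_avoidance n : R := \sum_i p 0 i * avoidance P w i n.

Lemma avoidance_le_mean i n : p 0 i * avoidance P w i n <= mean_avoidance n.
Proof.
rewrite /mean_avoidance (bigD1 i) //= lerDl; apply: sumr_ge0 => j _.
by rewrite mulr_ge0 ?avoidance_ge0.
Qed.

Lemma mean_avoidance_le1 n : \sum_i p 0 i = 1 -> mean_avoidance n <= 1.
Proof.
move=> <-; apply: ler_sum => i _; rewrite -[leRHS]mulr1.
by apply: ler_wpM2l; rewrite ?avoidance_le1.
Qed.

Lemma mean_avoidance_cat n k c : (forall j, avoidance P w j k <= c) ->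
  mean_avoidance (n + k) <= mean_avoidance n * c.
Proof.
move=> k_le; rewrite mulr_suml; apply: ler_sum => i _; rewrite -mulrA.
by apply: ler_wpM2l => //; apply: avoidance_cat.
Qed.

Lemma mean_avoidance_expn k c m : \sum_i p 0 i = 1 -> 0 <= c ->
  (forall j, avoidance P w j k <= c) -> mean_avoidance (m * k) <= c ^+ m.
Proof.
move=> p_sum1 c_ge0 k_le; elim: m => [|m IHm]; first exact: mean_avoidance_le1.
rewrite mulSn addnC exprSr; apply: le_trans (mean_avoidance_cat _ k_le) _.
exact: ler_wpM2r.
Qed.

End Avoidance.

Lemma stationary_Epath_behead (R : comNzRingType) (N : nat) (P : 'M[R]_N)
    (p : 'rV[R]_N) n (h : seq 'I_N -> R) : p *m P = p ->
  \sum_i p 0 i * Epath P n.+1 i (fun t => h (behead t)) =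
  \sum_i p 0 i * Epath P n i h.
Proof.
move=> pP; rewrite -[in RHS]pP; under eq_bigr do rewrite mulr_sumr.
rewrite exchange_big; apply: eq_bigr => j _ /=; rewrite mxE mulr_suml.
by apply: eq_bigr => i _; rewrite mulrA; congr (_ * _); apply: eq_Epath.
Qed.

Section StationaryAvoidance.
Variables (R : realType) (N : nat) (P : 'M[R]_N) (p : 'rV[R]_N).
Hypothesis P_ge0 : forall i j, 0 <= P i j.
Hypothesis P_sum1 : forall i, \sum_j P i j = 1.
Hypothesis p_ge0 : forall i, 0 <= p 0 i.
Hypothesis pP : p *m P = p.
Variables (a : 'I_N) (s : seq 'I_N).
Hypothesis s_gt0 : (0 < size s)%N.
Local Notation w := (a :: s).
Local Notation b := (last a s).

Lemma Epath_avoidance_drop i n :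
  Epath P (size s + n) i (fun t => (~~ infix w (behead t))%:R - (~~ infix w t)%:R)
  <= (i == a)%:R * delta P w * avoidance P w b n.
Proof.
rewrite -Epath_pred1 -EpathZr Epath_cat; apply: le_Epath => // t st.
case: eqP => [tw|/eqP tw]; last first.
  rewrite mul0r -(Epath0 P n (last i (i :: t))); apply: le_Epath => // t' _.
  rewrite [behead (_ :: t')]/=.
  suff -> : infix w ((i :: t) ++ t') = infix w (behead ((i :: t) ++ t')).
    by rewrite subrr.
  rewrite cat_cons infix_consl prefixE -cat_cons take_size_cat; last by rewrite /= st.
  by rewrite (negPf tw).
rewrite mul1r (_ : last i (i :: t) = b) ?tw //; apply: le_Epath => // t' _.
rewrite [behead (b :: t')]/= prefix_infix ?prefix_prefix // subr0.
rewrite ler_nat; case: (boolP (infix w (b :: t'))) => [|_]; last exact: leq_b1.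
rewrite [behead _]/=; case/lastP: (s) s_gt0 => [//|r c] _ wt.
by rewrite last_rcons in wt; rewrite cat_rcons infix_catl.
Qed.

(* By stationarity, the drop is the probability that [w] occurs at the first
   position and nowhere else. *)
Lemma mean_avoidance_drop n :
  mean_avoidance P w p (size s + n) - mean_avoidance P w p (size s + n.+1) <=
  p 0 a * delta P w * avoidance P w b n.+1.
Proof.
rewrite /mean_avoidance /avoidance -(stationary_Epath_behead _ _ pP) -addnS -sumrB.
under eq_bigr do rewrite -mulrBr -EpathB.
pose bound i := (i == a)%:R * delta P w * avoidance P w b n.+1.
apply: (@le_trans _ _ (\sum_i p 0 i * bound i)).
  by apply: ler_sum => i _; apply: ler_wpM2l => //; apply: Epath_avoidance_drop.
rewrite (bigD1 a) //= {1}/bound eqxx mul1r mulrA big1 ?addr0 // => i /negPf ia.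
by rewrite /bound ia !mul0r mulr0.
Qed.

Lemma mean_avoidance_drop_addn n k :
  mean_avoidance P w p (size s + n) - mean_avoidance P w p (size s + n + k) <=
  k%:R * (p 0 a * delta P w * avoidance P w b n).
Proof.
elim: k => [|k IHk]; first by rewrite addn0 subrr mul0r.
have := mean_avoidance_drop (n + k); rewrite !addnS !addnA => drop_k.
have D_ge0 : 0 <= p 0 a * delta P w by rewrite mulr_ge0 // prodr_ge0.
have := ler_wpM2l D_ge0 (avoidance_nincr w P_ge0 P_sum1 b (leqW (leq_addr k n))).
by rewrite -natr1 mulrDl mul1r; lra.
Qed.

Lemma mean_avoidance_le k c n : c < 1 -> (forall j, avoidance P w j k <= c) ->
  mean_avoidance P w p (size s + n) <=
  k%:R * (p 0 a * delta P w) / (1 - c) * avoidance P w b n.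
Proof.
move=> c_lt1 k_le; rewrite mulrAC ler_pdivlMr ?subr_gt0 // -mulrA mulrBr mulr1.
have := mean_avoidance_cat P_ge0 p_ge0 (size s + n) k_le.
by have := mean_avoidance_drop_addn n k; lra.
Qed.

End StationaryAvoidance.

(** * Comparison of two words *)

Section Comparison.
Variables (R : realType) (N : nat) (P : 'M[R]_N).
Implicit Types (i : 'I_N) (n : nat).

Lemma occurrence_addn i a s n : occurrence P (a :: s) i (n + size s) =
  Epath P n i (fun t => (last i t == a)%:R) * delta P (a :: s).
Proof.
rewrite /occurrence Epath_cat -EpathZr; apply: eq_Epath => t st.
rewrite -Epath_pred1; apply: eq_Epath => t' st'.
rewrite [behead _]/= (lastI i t) cat_rcons suffix_catr_long; last by rewrite /= st'.
by rewrite last_rcons suffixE [size (_ :: t')]/= st' subnn drop0.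
Qed.

Variables (a : 'I_N) (v s : seq 'I_N).
Hypothesis eq_size : size s = size v.
Hypothesis eq_last : last a s = last a v.
Hypothesis eq_delta : delta P (a :: s) = delta P (a :: v).
Local Notation u := (a :: v).
Local Notation w := (a :: s).
Local Notation b := (last a v).

Lemma eq_occurrence i : occurrence P w i = occurrence P u i.
Proof.
apply/funext => n; have [nv|vn] := ltnP n (size v).
  by rewrite !occurrence_short //= ltnS ?eq_size.
by rewrite -(subnK vn) occurrence_addn -eq_size occurrence_addn eq_delta.
Qed.

Hypothesis P_sum1 : forall i, \sum_j P i j = 1.

Lemma autocorrelation_exchange :
  autocorrelation P a v * first_occurrence P u b * avoidance P w b =
  autocorrelation P a s * first_occurrence P w b * avoidance P u b.
Proof.
have corr_u := first_occurrence_autocorrelation P_sum1 a v.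
have := first_occurrence_autocorrelation P_sum1 a s.
rewrite eq_last eq_occurrence => corr_w.
rewrite [_ * first_occurrence P u b]mulrC corr_u.
by rewrite [_ * first_occurrence P w b]mulrC corr_w mulrAC.
Qed.

Hypothesis v_gt0 : (0 < size v)%N.
Hypothesis u_prime : prime_word u.

Let s_gt0 : (0 < size s)%N. Proof. by rewrite eq_size. Qed.

Lemma avoidance_decomposition : avoidance P w b = avoidance P u b +
  (autocorrelation P a s - 1) * (first_occurrence P w b * avoidance P u b).
Proof.
have := autocorrelation_exchange; rewrite autocorrelation_prime // mul1r => exchange.
rewrite mulrBl mul1r mulrA -exchange !first_occurrenceE //; ring.
Qed.

Lemma avoidance_eq_prime : prime_word w -> avoidance P w b = avoidance P u b.
Proof.
move=> w_prime; rewrite avoidance_decomposition autocorrelation_prime //.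
by rewrite subrr mul0r addr0.
Qed.

Hypothesis P_ge0 : forall i j, 0 <= P i j.

Let autocorrelationB1_ge0 n : 0 <= (autocorrelation P a s - 1) n.
Proof.
rewrite fpsBE fps1E; case: n => [|n]; first by rewrite autocorrelation0 // subrr.
by rewrite subr0 autocorrelation_ge0.
Qed.

Let first_avoidance_ge0 n : 0 <= (first_occurrence P w b * avoidance P u b) n.
Proof. by apply: fpsM_ge0 => k; rewrite ?first_occurrence_ge0 ?avoidance_ge0. Qed.

Lemma avoidance_le n : avoidance P u b n <= avoidance P w b n.
Proof. by rewrite avoidance_decomposition fpsDE lerDl fpsM_ge0. Qed.

Lemma avoidance_gain k n : (0 < k)%N ->
  autocorrelation P a s k * (first_occurrence P w b * avoidance P u b) n <=
  avoidance P w b (k + n).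
Proof.
case: k => // k _.
rewrite [in leRHS]avoidance_decomposition fpsDE ler_wpDl ?avoidance_ge0 //.
apply: le_trans (fpsM_ge k.+1 n autocorrelationB1_ge0 first_avoidance_ge0).
by rewrite fpsBE fps1E subr0.
Qed.

End Comparison.

(** * Allowed words and prime words *)

Section PrimeWords.
Variable T : eqType.
Implicit Types (a : T) (v d w : seq T).

Lemma prime_word_last_neq a v : prime_word (a :: v) -> (0 < size v)%N -> last a v != a.
Proof.
move=> u_prime v_gt0; apply/eqP => last_a.
case: (u_prime (size v)) => /=; first by rewrite v_gt0 ltnSn.
rewrite subSnn /= take0.
by rewrite lastI last_a -cats1 drop_size_cat // size_belast.
Qed.

Lemma suffix_cat_border w k : (k <= size w)%N -> drop k w = take (size w - k) w ->
  suffix w (w ++ drop (size w - k) w).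
Proof.
move=> kw border; rewrite -{2}(cat_take_drop k w) border -catA cat_take_drop.
exact: suffix_suffix.
Qed.

(* An occurrence of [a :: v] in the periodic word starts at a multiple of the
   period; a period shorter than [a :: v] would be a period of that word. *)
Lemma prime_infix_periodic a v d n : a \notin d -> prime_word (a :: v) ->
  infix (a :: v) (mkseq (fun m => nth a (a :: d) (m %% (size d).+1)) n) ->
  (size v <= size d)%N /\ take (size v) d = v.
Proof.
move=> a_d u_prime; set y := fun m => _; move=> /infixP[r [r' yE]].
have yr i : (i <= size v)%N -> y (size r + i)%N = nth a (a :: v) i.
  move=> iv; have := congr1 (fun t => nth a t (size r + i)) yE.
  rewrite nth_mkseq; last first.
    by rewrite -(size_mkseq y n) yE !size_cat ltn_add2l ltn_addr.
  by rewrite nth_cat ifN -?leqNgt ?leq_addr // addKn nth_cat ltnS iv.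
have r_mod : (size r %% (size d).+1 = 0)%N.
  have := yr 0%N isT; rewrite addn0 /y /=; have := ltn_pmod (size r) (ltn0Sn (size d)).
  case: (_ %% _)%N => //= q qd qa.
  by rewrite -qa mem_nth in a_d.
have yE0 i : (i <= size v)%N -> y i = nth a (a :: v) i.
  by move=> iv; rewrite -yr // /y -modnDml r_mod.
have vd : (size v <= size d)%N.
  rewrite leqNgt; apply/negP => dv.
  case: (u_prime (size d).+1); first by rewrite /= ltnS.
  apply: (@eq_from_nth _ a); rewrite size_drop ?size_takel ?leq_subr // => i iv.
  have div : ((size d).+1 + i <= size v)%N by move: iv; rewrite /=; lia.
  rewrite nth_drop nth_take // -!yE0 ?(leq_trans _ div) ?leq_addl //.
  by rewrite /y modnDl.
split=> //; apply: (@eq_from_nth _ a); rewrite size_takel // => i iv.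
have := yE0 i.+1 iv; rewrite /y modn_small ?ltnS ?(leq_trans iv) //= => <-.
by rewrite nth_take.
Qed.

End PrimeWords.

Section Walks.
Variables (N : nat) (A : 'I_N -> 'I_N -> bool).
Implicit Types (i j a : 'I_N) (s t d : seq 'I_N).

Lemma allowed_word_path a s : allowed_word A (a :: s) -> path A a s.
Proof.
move=> [x [Ax [k wE]]].
have nth_w m : (m <= size s)%N -> nth a (a :: s) m = x (k + m)%N.
  by move=> ms; rewrite -[in LHS]wE nth_mkseq.
apply/(pathP a) => m ms; have := Ax (k + m)%N.
by rewrite -addnS -nth_w 1?ltnW // -nth_w.
Qed.

Lemma cycle_path_mkseq a d n : cycle A (a :: d) ->
  path A a (mkseq (fun m => nth a (a :: d) (m.+1 %% (size d).+1)) n).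
Proof.
move=> /= /(pathP a); rewrite size_rcons => cycleA.
set y := fun m => _; have step m : A (nth a (a :: d) (m %% (size d).+1)) (y m).
  rewrite /y -[m.+1]addn1 -modnDml addn1.
  move: (_ %% _)%N (ltn_pmod m (ltn0Sn (size d))) => q qd.
  have := cycleA _ qd; rewrite -rcons_cons nth_rcons /= qd nth_rcons if_same.
  by case: ltnP => dq; [rewrite modn_small|rewrite (_ : q = size d) ?modnn //; lia].
apply/(pathP a) => -[|m]; rewrite size_mkseq => mn; rewrite nth_mkseq //.
  by have := step 0%N; rewrite mod0n.
by rewrite [X in A X _]/= nth_mkseq ?(ltnW mn) //; apply: step.
Qed.

Hypothesis Airr : irreducible_mx A.

Lemma irreducible_walk i j : exists t, [/\ path A i t, last i t = j & j \in t].
Proof.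
have [k /andP[ik /connectP[t kt ->]]] := Airr i j.
by exists (k :: t); split; rewrite /= ?ik ?mem_last.
Qed.

Lemma first_return_cycle a s : path A a s -> exists d,
  [/\ cycle A (a :: d), a \notin d & (size s <= size d)%N -> take (size s) d = s].
Proof.
move=> As; have [t [At ta a_t]] := irreducible_walk (last a s) a.
pose r := s ++ t; have a_r : a \in r by rewrite mem_cat a_t orbT.
have ar : (index a r < size r)%N by rewrite index_mem.
exists (take (index a r) r); split.
- rewrite /= (_ : rcons _ _ = take (index a r).+1 r); last first.
    by rewrite (take_nth a ar) nth_index.
  by apply: take_path; rewrite cat_path As.
- by rewrite in_take // ltnn.
- rewrite size_takel ?(ltnW ar) // => sr.
  by rewrite take_takel // take_size_cat.
Qed.

Lemma prime_word_avoiding_path a v s : prime_word (a :: v) -> size s = size v ->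
  s <> v -> path A a s ->
  forall n, exists t, [/\ size t = n, path A a t & ~~ infix (a :: v) (a :: t)].
Proof.
move=> u_prime eq_size sv /first_return_cycle[d [cycleA a_d sd]] n.
pose y m := nth a (a :: d) (m %% (size d).+1); exists (mkseq (y \o succn) n).
split; [exact: size_mkseq|exact: cycle_path_mkseq|].
apply/negP; rewrite (_ : a :: mkseq _ _ = mkseq y n.+1).
  by move=> /(prime_infix_periodic a_d u_prime)[]; rewrite -eq_size => /sd -> /sv.
by rewrite /mkseq /= -[1%N]/(1 + 0)%N iotaDl -map_comp.
Qed.

End Walks.

Section CompatibleStochastic.
Variables (R : realType) (N : nat) (A : 'I_N -> 'I_N -> bool) (P : 'M[R]_N).
Hypothesis AP : compatible_stochastic A P.
Implicit Types (i j a : 'I_N) (s t : seq 'I_N).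

Let P_ge0 i j : 0 <= P i j. Proof. by have [] := AP. Qed.
Let P_sum1 i : \sum_j P i j = 1. Proof. by have [_ []] := AP. Qed.
Let P_gt0 i j : (0 < P i j) = A i j. Proof. by have [_ []] := AP. Qed.

Lemma delta_ge_expn :
  exists2 e, 0 < e & forall i t, path A i t -> e ^+ size t <= delta P (i :: t).
Proof.
pose e := \big[Num.min/1]_(ij | A ij.1 ij.2) P ij.1 ij.2.
have e_gt0 : 0 < e by rewrite lt_bigmin // => -[i j] /=; rewrite P_gt0.
exists e => // i t; elim: t i => [|j t IHt] i /=; first by rewrite delta1.
move=> /andP[ij jt]; rewrite delta_cons exprS.
apply: ler_pM; rewrite ?exprn_ge0 ?(ltW e_gt0) ?IHt //.
exact: (bigmin_le_cond _ (j := (i, j))).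
Qed.

Lemma delta_gt0 i t : path A i t -> 0 < delta P (i :: t).
Proof.
have [e e_gt0 e_le] := delta_ge_expn => /e_le; apply: lt_le_trans.
by rewrite exprn_gt0.
Qed.

Lemma autocorrelation_nonprime a s : path A a s -> last a s != a ->
  ~ prime_word (a :: s) -> exists2 k, (0 < k)%N & 0 < autocorrelation P a s k.
Proof.
set w := a :: s => As ba /existsNP[k] /not_implyP[/andP[k_gt0 ks] /contrapT border].
have {}ks : (k <= size s)%N by [].
pose r := take (size s - k) s; pose z := drop (size s - k) s.
have w_k : (size w - k = (size s - k).+1)%N by rewrite /= subSn.
have last_r : last a r = last a s.
  by rewrite -[RHS]/(last a w) -(cat_take_drop k w) border w_k last_cat.
have k_lt : (k < size s)%N.
  rewrite ltn_neqAle ks andbT; apply: contraNneq ba => k_eq.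
  by rewrite -last_r /r k_eq subnn take0.
have size_z : size z = k by rewrite size_drop subKn.
have z_path : path A (last a s) z.
  move: As; rewrite -{1}(cat_take_drop (size s - k) s) cat_path -/r last_r.
  by case/andP.
exists k => //; rewrite autocorrelationE k_lt -size_z.
apply: lt_le_trans (Epath_ge_delta (last a s) z P_ge0
  (h := fun t => (suffix w (w ++ behead t))%:R) _) => //.
rewrite [behead _]/= /z -[drop _ s]/(drop (size s - k).+1 w) -w_k.
by rewrite suffix_cat_border ?(leqW ks) // mulr1 w_k delta_gt0.
Qed.

Lemma avoidance_lt1 (a j : 'I_N) s : irreducible_mx A -> path A a s ->
  exists n, avoidance P (a :: s) j n < 1.
Proof.
move=> Airr As; have [t [At ta _]] := irreducible_walk Airr j a.
exists (size (t ++ s)); rewrite -[ltRHS](Epath_cst P_sum1 (size (t ++ s)) j).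
rewrite -subr_gt0 -EpathB.
apply: lt_le_trans (Epath_ge_delta j (t ++ s) P_ge0
  (h := fun t => 1 - (~~ infix (a :: s) t)%:R) _) => [|t'].
  rewrite (_ : infix _ _); first by rewrite subr0 mulr1 delta_gt0 // cat_path At ta.
  by rewrite -cat_cons (lastI j t) cat_rcons ta suffixW // suffix_suffix.
by rewrite subr_ge0 lern1 leq_b1.
Qed.

Lemma avoidance_uniform_lt1 a s : irreducible_mx A -> path A a s ->
  exists k c, [/\ 0 < c, c < 1 & forall j, avoidance P (a :: s) j k <= c].
Proof.
move=> Airr As; have [k kP] := choice (fun j => avoidance_lt1 j Airr As).
pose K := (\sum_j k j)%N; pose c := \big[Num.max/1/2]_j avoidance P (a :: s) j K.
exists K, c; split=> [||j]; last exact: le_bigmax.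
- by apply: lt_le_trans (bigmax_ge_id _ _ _ _); lra.
- apply: bigmax_lt; first by lra.
  move=> j _; apply: le_lt_trans (kP j); apply: avoidance_nincr => //.
  by rewrite /K (bigD1 j) //= leq_addr.
Qed.

Lemma stationary_gt0 (p : 'rV[R]_N) i : irreducible_mx A -> stationary_vector P p ->
  0 < p 0 i.
Proof.
move=> Airr [p_ge0 [p_sum1 pP]].
have [j pj] : exists j, 0 < p 0 j.
  apply: contrapT => /forallNP p_le0; have := oner_neq0 R.
  rewrite -p_sum1 big1 ?eqxx // => j _.
  by apply/eqP; rewrite eq_le p_ge0 andbT leNgt; apply/negP.
have [t [At <- _]] := irreducible_walk Airr j i.
elim: t j pj At => [|k t IHt] j pj //= /andP[jk kt]; apply: IHt => //.
rewrite -pP mxE (bigD1 j) //= ltr_pwDl ?mulr_gt0 ?P_gt0 //.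
by apply: sumr_ge0 => l _; rewrite mulr_ge0.
Qed.

Lemma prime_word_avoidance_ge a v s : irreducible_mx A -> prime_word (a :: v) ->
  size s = size v -> s <> v -> path A a s ->
  exists2 e, 0 < e & forall n, e ^+ n <= avoidance P (a :: v) a n.
Proof.
move=> Airr u_prime eq_size sv As; have [e e_gt0 e_le] := delta_ge_expn.
exists e => // n.
have [t [<- At avoid_t]] := prime_word_avoiding_path Airr u_prime eq_size sv As n.
apply: le_trans (e_le _ _ At) _; rewrite -[leLHS]mulr1.
have := Epath_ge_delta a t P_ge0 (h := fun t => (~~ infix (a :: v) t)%:R).
by rewrite avoid_t; apply.
Qed.

End CompatibleStochastic.

(** * Exponential growth rates *)

Section GrowthRates.
Variable R : realType.
Implicit Types (a f g : nat -> R) (L : R).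
Local Open Scope classical_set_scope.
Local Open Scope ring_scope.

Lemma cvg_div_natr (c : R) : c / n%:R @[n --> \oo] --> 0.
Proof.
have : c / (n + 1)%:R @[n --> \oo] --> c * 0.
  under eq_fun do rewrite addn1.
  by apply: cvgM; [exact: cvg_cst|exact: cvg_harmonic].
by rewrite mulr0 (cvg_shiftn 1 (fun n => c / n%:R)).
Qed.

Section Fekete.
Variable a : nat -> R.
Hypothesis subadditive_a : forall m n, a (m + n)%N <= a m + a n.

Lemma subadditive_muln q n r : a (q * n + r)%N <= q%:R * a n + a r.
Proof.
elim: q => [|q IHq]; first by rewrite mul0r add0r.
rewrite mulSn -addnA -natr1 mulrDl mul1r.
have := subadditive_a n (q * n + r); lra.
Qed.

Lemma subadditive_linear_ub n : (0 < n)%N ->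
  exists B, forall m, a m <= m%:R * (a n / n%:R) + B.
Proof.
move=> n_gt0; exists (\sum_(r < n) `|a r - r%:R * (a n / n%:R)|) => m.
have n_neq0 : n%:R != 0 :> R by rewrite pnatr_eq0 -lt0n.
have := subadditive_muln (m %/ n) n (m %% n); rewrite -divn_eq => a_m.
have mE : m%:R * (a n / n%:R) = (m %/ n)%:R * a n + (m %% n)%:R * (a n / n%:R).
  by rewrite {1}(divn_eq m n) natrD natrM; field.
rewrite mE (bigD1 (Ordinal (ltn_pmod m n_gt0))) //=.
set c := (m %% n)%:R * _ in mE *; have := ler_norm (a (m %% n)%N - c).
set B := \sum_(_ < _ | _) _; have : 0 <= B by apply: sumr_ge0.
lra.
Qed.

Lemma fekete : has_lbound [set a n.+1 / n.+1%:R | n in [set: nat]] ->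
  exists2 L : R, a n / n%:R @[n --> \oo] --> L & forall n, n%:R * L <= a n.
Proof.
set S := [set _ | _ in _] => lbS.
have infS : has_inf S by split=> //; exists (a 1%N / 1%:R), 0%N.
have inf_le n : n%:R * inf S <= a n.
  case: n => [|n]; first by have := subadditive_a 0 0; rewrite addn0 mul0r; lra.
  by rewrite mulrC -ler_pdivlMr // ge_inf //; exists n.
exists (inf S) => //; apply/cvgrPdist_le => e e_gt0.
have e2_gt0 : 0 < e / 2 by lra.
have [_ [n _ <-] n_lt] := inf_adherent e2_gt0 infS.
have [B a_le] := subadditive_linear_ub (ltn0Sn n).
near=> m; have m_gt0 : 0 < m%:R :> R by rewrite ltr0n; near: m; exists 1%N.
rewrite ler_distlC; apply/andP; split.
  by have := inf_le m; rewrite mulrC -ler_pdivlMr //; lra.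
have a_m : a m / m%:R <= a n.+1 / n.+1%:R + B / m%:R.
  by rewrite ler_pdivrMr // mulrDl divfK ?gt_eqF // mulrC.
apply: le_trans a_m _; rewrite [e]splitr addrA lerD ?(ltW n_lt) //.
by near: m; apply: cvgr_le (cvg_div_natr B) _ _.
Unshelve. all: by end_near.
Qed.

End Fekete.

Definition growth_rate f L := ln (f n) / n%:R @[n --> \oo] --> L.

Lemma growth_rate_shift f L d : growth_rate f L -> growth_rate (fun n => f (n + d)%N) L.
Proof.
move=> fL; have : ln (f (n + d)%N) / (n + d)%:R * (1 + d%:R / n%:R) @[n --> \oo] --> L.
  rewrite -[L]mulr1 -[X in _ * X]addr0; apply: cvgM.
    by rewrite (cvg_shiftn d (fun n => ln (f n) / n%:R)).
  by apply: cvgD (cvg_div_natr _); apply: cvg_cst.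
rewrite /growth_rate; apply: cvg_trans; apply: near_eq_cvg; near=> n.
have n_gt0 : (0 < n)%N by near: n; exists 1%N.
by rewrite natrD; field; rewrite -natrD !pnatr_eq0 addn_eq0 gtn_eqF.
Unshelve. all: by end_near.
Qed.

Lemma growth_rateZ f L c : 0 < c -> (forall n, 0 < f n) -> growth_rate f L ->
  growth_rate (fun n => c * f n) L.
Proof.
move=> c_gt0 f_gt0 fL; rewrite /growth_rate.
under eq_fun do rewrite lnM ?posrE // mulrDl.
by rewrite -[L]add0r; apply: cvgD => //; apply: cvg_div_natr.
Qed.

Lemma ler_ln_div f g n : 0 < f n -> f n <= g n -> ln (f n) / n%:R <= ln (g n) / n%:R.
Proof.
move=> f_gt0 fg; rewrite ler_wpM2r ?invr_ge0 // ler_ln ?posrE //.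
exact: lt_le_trans fg.
Qed.

Lemma growth_rate_le f g L L' : (forall n, 0 < f n) -> (forall n, f n <= g n) ->
  growth_rate f L -> growth_rate g L' -> L <= L'.
Proof.
move=> f_gt0 fg fL gL'; apply: (ler_cvg_to fL gL').
by near=> n; apply: ler_ln_div.
Unshelve. all: by end_near.
Qed.

Lemma growth_rate_squeeze f g L c c' d : (forall n, 0 < f n) -> (forall n, 0 < g n) ->
  (forall n, f (n + d)%N <= c * g n) -> (forall n, g n <= c' * f n) ->
  growth_rate f L -> growth_rate g L.
Proof.
move=> f_gt0 g_gt0 fg gf fL.
have c_gt0 : 0 < c by have := lt_le_trans (f_gt0 _) (fg 0%N); rewrite pmulr_lgt0.
have c'_gt0 : 0 < c' by have := lt_le_trans (g_gt0 _) (gf 0%N); rewrite pmulr_lgt0.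
have lb n : c^-1 * f (n + d)%N <= g n by rewrite ler_pdivrMl.
apply: (squeeze_cvgr (f := fun n => ln (c^-1 * f (n + d)%N) / n%:R)
                     (h := fun n => ln (c' * f n) / n%:R)).
- near=> n; rewrite (@ler_ln_div g (fun n => c' * f n)) // andbT.
  by apply: (@ler_ln_div (fun n => c^-1 * f (n + d)%N)); rewrite // mulr_gt0 ?invr_gt0.
- by apply: growth_rateZ; rewrite ?invr_gt0 //; apply: growth_rate_shift.
- exact: growth_rateZ.
Unshelve. all: by end_near.
Qed.

Lemma submultiplicative_growth_rate f d e : 0 < d -> 0 < e ->
  (forall n, d * e ^+ n <= f n) -> (forall m n, f (m + n)%N <= f m * f n) ->
  exists2 L, growth_rate f L & forall n, expR L ^+ n <= f n.
Proof.
move=> d_gt0 e_gt0 f_ge f_submul.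
have de_gt0 n : 0 < d * e ^+ n by rewrite mulr_gt0 ?exprn_gt0.
have f_gt0 n : 0 < f n by apply: lt_le_trans (f_ge n).
have [m n||L fL L_le] := @fekete (fun n => ln (f n)).
- by rewrite -lnM ?posrE // ler_ln ?posrE ?mulr_gt0.
- exists (ln e - `|ln d|) => _ [n _ <-]; rewrite ler_pdivlMr //.
  have := f_ge n.+1; rewrite -ler_ln ?posrE // lnM ?posrE ?exprn_gt0 // lnXn //.
  rewrite -[ln e *+ _]mulr_natl; have := ler_norm (- ln d); rewrite normrN.
  have : 0 <= n%:R :> R by []. have := normr_ge0 (ln d); rewrite -natr1; nra.
- exists L => // n; rewrite -expRM_natl -[leRHS]lnK ?posrE // ler_expR.
  exact: L_le.
Qed.

Lemma growth_rate_geometric_ub f L l : (forall n, 0 < f n) -> growth_rate f L ->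
  L < l -> exists C, forall n, f n <= C * expR l ^+ n.
Proof.
move=> f_gt0 fL /(cvgr_lt _ fL)[m _ f_lt].
have q_gt0 n : 0 < expR l ^+ n by rewrite exprn_gt0 ?expR_gt0.
exists (1 + \sum_(i < m.+1) f i / expR l ^+ i) => n; rewrite -ler_pdivrMr //.
have sum_ge0 (Q : pred 'I_m.+1) : 0 <= \sum_(i < m.+1 | Q i) f i / expR l ^+ i.
  by apply: sumr_ge0 => i _; rewrite divr_ge0 ?ltW.
have [nm|mn] := ltnP n m.+1.
  by rewrite (bigD1 (Ordinal nm)) //= addrCA lerDl addr_ge0.
rewrite ler_wpDr // ler_pdivrMr // mul1r -expRM_natl -[leLHS]lnK ?posrE // ler_expR.
rewrite mulrC -ler_pdivrMr ?ltr0n; last exact: leq_ltn_trans mn.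
by apply/ltW/f_lt/ltnW.
Qed.

Lemma is_cvg_pseries_growth f L x : (forall n, 0 < f n) -> growth_rate f L ->
  0 < x -> expR L * x < 1 -> cvgn (pseries f x).
Proof.
move=> f_gt0 fL x_gt0 Lx_lt1.
have expL_x : expR (- ln x) = x^-1 by rewrite expRN lnK ?posrE.
have L_lt : L < - ln x.
  by rewrite -ltr_expR expL_x -[x^-1]mul1r ltr_pdivlMr.
have [C f_le] := growth_rate_geometric_ub f_gt0 fL (midf_lt L_lt).1.
set q := expR _ in f_le; have q_gt0 : 0 < q by exact: expR_gt0.
have qx_lt1 : `|q * x| < 1.
  rewrite gtr0_norm ?mulr_gt0 // -ltr_pdivlMr // mul1r -expL_x ltr_expR.
  exact: (midf_lt L_lt).2.
apply: (series_le_cvg _ _ _ (is_cvg_geometric_series (a := C) qx_lt1)) => n.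
- by rewrite mulr_ge0 ?exprn_ge0 ?ltW.
- rewrite /= exprMn mulrA mulr_ge0 ?exprn_ge0 ?(ltW x_gt0) //.
    by apply: le_trans (f_le n); apply: ltW.
- by rewrite /= exprMn mulrA ler_wpM2r ?exprn_ge0 ?(ltW x_gt0).
Qed.

Definition exponential_decay f L := [/\ L < 0, forall n, 0 < f n, growth_rate f L &
  exists2 c, 0 < c & forall n, c * expR L ^+ n <= f n].

Lemma exponential_decay_le f g L L' : (forall n, f n <= g n) ->
  exponential_decay f L -> exponential_decay g L' -> L <= L'.
Proof. by move=> fg [_ f_gt0 fL _] [_ _ gL' _]; apply: growth_rate_le fL gL'. Qed.

Lemma exponential_decay_unique f L L' :
  exponential_decay f L -> exponential_decay f L' -> L = L'.
Proof. by move=> [_ _ fL _] [_ _ fL' _]; apply: cvg_unique fL fL'. Qed.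

End GrowthRates.

(** * Growth of the solutions of a renewal inequality *)

Section RenewalGrowth.
Variable R : realType.
Implicit Types (f g U V F : fps R) (x c phi L : R).
Local Open Scope classical_set_scope.
Local Open Scope ring_scope.

Lemma pseriesS f x n : pseries f x n.+1 = pseries f x n + f n * x ^+ n.
Proof. by rewrite /pseries /series /= big_nat_recr. Qed.

Lemma pseries0 f x : pseries f x 0%N = 0.
Proof. by rewrite /pseries /series /= big_geq. Qed.

Lemma nondecreasing_pseries f x : (forall n, 0 <= f n) -> 0 <= x ->
  nondecreasing_seq (pseries f x).
Proof.
move=> f_ge0 x_ge0; apply: nondecreasing_series => n _ _.
by rewrite mulr_ge0 ?exprn_ge0.
Qed.

Lemma pseriesM f g x n :
  pseries (f * g) x n = \sum_(i < n) f i * x ^+ i * pseries g x (n - i)%N.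
Proof.
elim: n => [|n IHn]; first by rewrite pseries0 big_ord0.
rewrite pseriesS IHn fpsME mulr_suml 2!big_ord_recr /= subnn subSnn.
rewrite pseriesS pseries0 add0r addrA -big_split; congr (_ + _); last by ring.
apply: eq_bigr => i _ /=; rewrite subSn ?(ltnW (ltn_ord i)) // pseriesS mulrDr.
have -> : x ^+ n = x ^+ i * x ^+ (n - i) by rewrite -exprD subnKC // ltnW.
ring.
Qed.

Lemma pseriesM_ge f g x m n : (forall k, 0 <= f k) -> (forall k, 0 <= g k) -> 0 <= x ->
  pseries f x m * pseries g x n <= pseries (f * g) x (m + n)%N.
Proof.
move=> f_ge0 g_ge0 x_ge0; have g_nd := nondecreasing_pseries g_ge0 x_ge0.
have term_ge0 i k : 0 <= f i * x ^+ i * pseries g x k.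
  by rewrite !mulr_ge0 ?exprn_ge0 // -(pseries0 g x) g_nd.
rewrite pseriesM big_split_ord /= -[leLHS]addr0 lerD ?sumr_ge0 //.
rewrite /pseries [X in X * _]/series /= big_mkord mulr_suml; apply: ler_sum => i _.
by rewrite ler_wpM2l ?mulr_ge0 ?exprn_ge0 // g_nd //; have := ltn_ord i; lia.
Qed.

Lemma pseriesB f g x n : pseries (f - g) x n = pseries f x n - pseries g x n.
Proof.
rewrite /pseries /series /= -sumrB; apply: eq_bigr => i _.
by rewrite fpsBE mulrBl.
Qed.

Lemma pseries_sub1XM f x n :
  pseries ((1 - fpsX R) * f) x n.+1 = pseries f x n.+1 - x * pseries f x n.
Proof.
elim: n => [|n IHn]; first by rewrite !pseriesS !pseries0 fps_sub1XM0 mulr0 subr0.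
by rewrite [LHS]pseriesS IHn fps_sub1XMS !pseriesS exprS; ring.
Qed.

Lemma pseries1 x n : pseries (1 : fps R) x n.+1 = 1.
Proof.
elim: n => [|n IHn]; first by rewrite pseriesS pseries0 add0r mulr1.
by rewrite pseriesS IHn mul0r addr0.
Qed.

Lemma pseries_shift_le f x k n : (forall n, 0 <= f n) -> 1 <= x ->
  pseries (fun n => f (k + n)%N) x n <= pseries f x (k + n)%N.
Proof.
move=> f_ge0 x_ge1; rewrite /pseries /series /= !big_mkord big_split_ord /=.
rewrite ler_wpDl ?sumr_ge0 // => [i _|].
  by rewrite mulr_ge0 ?exprn_ge0 // (le_trans _ x_ge1).
by apply: ler_sum => i _; rewrite ler_wpM2l // ler_weXn2l // leq_addl.
Qed.

(* Sum the hypothesis against [x ^+ n]: as the sum of [F] is [1 + (x - 1) V(x)],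
   this gives [phi * (1 + (x - 1) V(x)) * U(x) <= V(x)]. *)
Lemma renewal_pseries_lt1 U V F x phi k m : (forall n, 0 <= U n) ->
  (forall n, 0 <= V n) -> (forall n, 0 <= F n) ->
  F = 1 - (1 - fpsX R) * V -> 0 <= phi ->
  (forall n, phi * (F * U) n <= V (k + n)%N) -> 1 < x -> cvgn (pseries V x) ->
  phi * (x - 1) * pseries U x m < 1.
Proof.
move=> U_ge0 V_ge0 F_ge0 F_eq phi_ge0 FU_le x_gt1 cvgV.
have x_ge0 : 0 <= x by lra.
pose S := limn (pseries V x); have V_nd := nondecreasing_pseries V_ge0 x_ge0.
have V_le n : pseries V x n <= S by exact: nondecreasing_cvgn_le.
have S_ge0 : 0 <= S by rewrite -(pseries0 V x).
have F_cvg : pseries F x n.+1 @[n --> \oo] --> 1 + (x - 1) * S.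
  rewrite F_eq; under eq_fun do rewrite pseriesB pseries1 pseries_sub1XM.
  have -> : 1 + (x - 1) * S = 1 - (S - x * S) by ring.
  apply: cvgB; [exact: cvg_cst|apply: cvgB; last by apply: cvgMr].
  by rewrite (cvg_shiftS (pseries V x)).
have FU_lim : phi * (1 + (x - 1) * S) * pseries U x m <= S.
  have lim_le : phi * pseries F x n.+1 * pseries U x m @[n --> \oo] -->
      phi * (1 + (x - 1) * S) * pseries U x m.
    by apply: cvgMl; apply: cvgMr.
  apply: (ler_cvg_to lim_le (cvg_cst S)); near=> n.
  apply: le_trans (V_le (k + (n.+1 + m))%N).
  apply: le_trans (pseries_shift_le _ _ V_ge0 (ltW x_gt1)).
  rewrite -mulrA.
  apply: le_trans (ler_wpM2l phi_ge0 (pseriesM_ge _ _ F_ge0 U_ge0 x_ge0)) _.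
  rewrite /pseries /series /= mulr_sumr; apply: ler_sum => i _.
  by rewrite mulrA ler_wpM2r ?exprn_ge0.
have sum_gt0 : 0 < 1 + (x - 1) * S by rewrite ltr_pwDl // mulr_ge0 // subr_ge0 ltW.
rewrite -(ltr_pM2r sum_gt0) mul1r.
have := ler_wpM2l (ltW (_ : 0 < x - 1)) FU_lim; rewrite subr_gt0 => /(_ x_gt1); lra.
Unshelve. all: by end_near.
Qed.

Lemma renewal_growth_lt U V F L L' c phi k : L < 0 -> 0 < c -> 0 < phi ->
  (forall n, c * expR L' ^+ n <= U n) -> (forall n, 0 < V n) -> growth_rate V L ->
  (forall n, 0 <= F n) -> F = 1 - (1 - fpsX R) * V ->
  (forall n, phi * (F * U) n <= V (k + n)%N) -> L' < L.
Proof.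
move=> L_lt0 c_gt0 phi_gt0 U_ge V_gt0 VL F_ge0 F_eq FU_le.
rewrite ltNge; apply/negP => LL'.
pose q := expR L; have q_gt0 : 0 < q by exact: expR_gt0.
have q_lt1 : q < 1 by rewrite expR_lt1.
pose psi := phi * c; have psi_gt0 : 0 < psi by exact: mulr_gt0.
pose y := (1 + psi) / (q + psi).
have yq : y < q^-1.
  rewrite ltr_pdivrMr ?addr_gt0 // mulrDr mulVf ?gt_eqF // ltrD2l.
  by rewrite ltr_pMl // invf_gt1.
have y_gt1 : 1 < y by rewrite ltr_pdivlMr ?addr_gt0 // mul1r ltrD2r.
pose x := (y + q^-1) / 2; have [yx xq] := midf_lt yq; rewrite -/x in yx xq.
have x_gt1 : 1 < x by exact: lt_trans yx.
have x_gt0 : 0 < x by lra.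
have qx_lt1 : q * x < 1 by rewrite mulrC -ltr_pdivlMr // mul1r.
have U_pos n : c * q ^+ n <= U n.
  by apply: le_trans (U_ge n); rewrite ler_pM2l // lerXn2r ?nnegrE ?expR_ge0 ?ler_expR.
have phi_x_gt0 : 0 < phi * (x - 1) by rewrite mulr_gt0 ?subr_gt0.
have sum_le1 : c / (1 - q * x) <= (phi * (x - 1))^-1.
  have qx_norm : `|q * x| < 1 by rewrite gtr0_norm // mulr_gt0.
  apply: (ler_cvg_to (cvg_geometric_series qx_norm) (cvg_cst _)); near=> n.
  rewrite -[leRHS]mulr1 ler_pdivlMl //.
  apply: le_trans (ltW
    (renewal_pseries_lt1 n _ _ F_ge0 F_eq (ltW phi_gt0) FU_le x_gt1 _)).
  - rewrite ler_pM2l // /pseries /series /=; apply: ler_sum => i _.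
    by rewrite exprMn mulrA ler_wpM2r ?exprn_ge0 ?(ltW x_gt0).
  - by move=> i; apply: le_trans (U_pos i); rewrite mulr_ge0 ?exprn_ge0 ?ltW.
  - by move=> i; exact: ltW.
  - exact: is_cvg_pseries_growth VL _ _.
move: sum_le1 yx; rewrite ler_pdivrMr ?subr_gt0 // ler_pdivlMl //.
by rewrite ltr_pdivrMr ?addr_gt0 // /psi; lra.
Unshelve. all: by end_near.
Qed.

End RenewalGrowth.

(** * Escape rates *)

Lemma sum_tupleS (V : nmodType) (T : finType) n (F : seq T -> V) :
  \sum_(t : n.+1.-tuple T) F t = \sum_x \sum_(t : n.-tuple T) F (x :: t).
Proof.
rewrite pair_big /=.
rewrite (reindex (fun xt : T * n.-tuple T => [tuple of xt.1 :: xt.2])) //.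
exists (fun t => (thead t, [tuple of behead t])) => [[x t] _|t _] /=.
  by congr pair; apply: val_inj.
by rewrite [t in RHS]tuple_eta.
Qed.

Lemma forall_take_drop_neq (T : eqType) (w t : seq T) m : size t = (m + size w)%N ->
  [forall i : 'I_m.+1, take (size w) (drop i t) != w] = ~~ infix w t.
Proof.
move=> st; apply/forallP/idP => [w_neq|/negP wt i]; last first.
  apply/eqP => wE; apply: wt; apply/infixP.
  by exists (take i t), (drop (size w) (drop i t)); rewrite -{1}wE !cat_take_drop.
apply/negP => /infixP[r [r' tE]].
have rm : (size r < m.+1)%N.
  by rewrite ltnS -(leq_add2r (size w)) -st tE !size_cat addnA leq_addr.
by have := w_neq (Ordinal rm); rewrite tE /= drop_size_cat // take_size_cat // eqxx.
Qed.

Section SurvivorMeasure.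
Variables (R : realType) (N : nat) (P : 'M[R]_N) (p : 'rV[R]_N).
Implicit Types (m n : nat).

Lemma sum_delta_tuple n i (h : seq 'I_N -> R) :
  \sum_(t : n.-tuple 'I_N) delta P (i :: t) * h (i :: t) = Epath P n i h.
Proof.
elim: n i h => [|n IHn] i h /=.
  rewrite (big_pred1 [tuple]) => [|t]; last by apply/esym/eqP; rewrite [t]tuple0.
  by rewrite delta1 mul1r.
rewrite (sum_tupleS n (fun t => delta P (i :: t) * h (i :: t))).
apply: eq_bigr => j _; rewrite -IHn mulr_sumr; apply: eq_bigr => t _.
by rewrite delta_cons mulrA.
Qed.

Lemma sum_mu_cyl n (Q : pred (seq 'I_N)) :
  \sum_(t : n.+1.-tuple 'I_N | Q t) mu_cyl P p t =
  \sum_i p 0 i * Epath P n i (fun t => (Q t)%:R).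
Proof.
rewrite big_mkcond (sum_tupleS n (fun t => if Q t then mu_cyl P p t else 0)).
apply: eq_bigr => i _; rewrite -sum_delta_tuple mulr_sumr; apply: eq_bigr => t _ /=.
by case: (Q _); rewrite ?mulr1 ?mulr0.
Qed.

Lemma mu_WE (a : 'I_N) s m :
  mu_W P p (a :: s) m = mean_avoidance P (a :: s) p (m + size s).
Proof.
rewrite /mu_W /= addnS.
rewrite (sum_mu_cyl _
  (fun t => [forall i : 'I_m.+1, take (size s).+1 (drop i t) != a :: s])).
apply: eq_bigr => i _; congr (_ * _).
by apply: eq_Epath => t st; rewrite -(forall_take_drop_neq (m := m)) //= st addnS.
Qed.

Lemma rho_growth_rate (a : 'I_N) s L :
  growth_rate (mean_avoidance P (a :: s) p) L -> rho P p (a :: s) = - L.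
Proof.
move=> ML; rewrite /rho; congr (- _); apply/cvg_lim => //.
by under eq_fun do rewrite mu_WE; apply: growth_rate_shift.
Qed.

End SurvivorMeasure.

Section EscapeRates.
Variables (R : realType) (N : nat) (A : 'I_N -> 'I_N -> bool) (P : 'M[R]_N).
Variable p : 'rV[R]_N.
Hypothesis Airr : irreducible_mx A.
Hypothesis AP : compatible_stochastic A P.
Hypothesis pS : stationary_vector P p.
Implicit Types (a i j : 'I_N) (s v w : seq 'I_N).

Let P_ge0 i j : 0 <= P i j. Proof. by have [] := AP. Qed.
Let P_sum1 i : \sum_j P i j = 1. Proof. by have [_ []] := AP. Qed.
Let p_gt0 i : 0 < p 0 i. Proof. exact: (stationary_gt0 AP i Airr pS). Qed.
Let p_ge0 i : 0 <= p 0 i. Proof. exact: ltW. Qed.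

Lemma mean_avoidance_growth_rate w j d e : 0 < d -> 0 < e ->
  (forall n, d * e ^+ n <= avoidance P w j n) ->
  exists2 L, growth_rate (mean_avoidance P w p) L &
    exists2 c, 0 < c & forall n, c * expR L ^+ n <= mean_avoidance P w p n.
Proof.
move=> d_gt0 e_gt0 avoid_ge; pose c := \big[Num.min/1]_i p 0 i.
have c_gt0 : 0 < c by rewrite lt_bigmin.
have avoid_le i n : avoidance P w i n <= mean_avoidance P w p n / c.
  rewrite ler_pdivlMr // mulrC; apply: le_trans (avoidance_le_mean w P_ge0 p_ge0 i n).
  by rewrite ler_wpM2r ?avoidance_ge0 // bigmin_le.
have M_gt0 n : 0 < mean_avoidance P w p n.
  apply: lt_le_trans (avoidance_le_mean w P_ge0 p_ge0 j n); rewrite mulr_gt0 //.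
  by apply: lt_le_trans (avoid_ge n); rewrite mulr_gt0 ?exprn_gt0.
have [||L ML L_le] := submultiplicative_growth_rate
    (f := fun n => mean_avoidance P w p n / c) d_gt0 e_gt0.
- by move=> n; apply: le_trans (avoid_ge n) _.
- move=> m n; rewrite mulrAC ler_wpM2r ?invr_ge0 ?(ltW c_gt0) //.
  by apply: mean_avoidance_cat.
exists L.
  have -> : mean_avoidance P w p = fun n => c * (mean_avoidance P w p n / c).
    by apply/funext => n; rewrite mulrC divfK ?gt_eqF.
  by apply: growth_rateZ => // n; rewrite divr_gt0.
by exists c => // n; rewrite mulrC -ler_pdivlMr.
Qed.

Lemma mean_avoidance_growth_lt0 a s L c : path A a s -> 0 < c ->
  (forall n, c * expR L ^+ n <= mean_avoidance P (a :: s) p n) -> L < 0.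
Proof.
move=> As c_gt0 c_le; rewrite ltNge; apply/negP => L_ge0.
have [k [q [q_gt0 q_lt1 k_le]]] := avoidance_uniform_lt1 AP Airr As.
have c_le_q m : c <= q ^+ m.
  have [_ [p_sum1 _]] := pS.
  apply: le_trans (mean_avoidance_expn P_ge0 P_sum1 p_ge0 m p_sum1 (ltW q_gt0) k_le).
  apply: le_trans (c_le _); rewrite ler_peMr ?(ltW c_gt0) // exprn_ege1 //.
  by rewrite -expR0 ler_expR.
have q_norm : `|q| < 1 by rewrite gtr0_norm.
have : c <= 0.
  apply: (ler_cvg_to (cvg_cst c) (cvg_expr q_norm)).
  by near=> m; apply: c_le_q.
by rewrite leNgt c_gt0.
Unshelve. all: by end_near.
Qed.

Lemma avoidance_exponential_decay a s j d e : path A a s -> (0 < size s)%N ->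
  0 < d -> 0 < e -> (forall n, d * e ^+ n <= avoidance P (a :: s) j n) ->
  exists2 L, exponential_decay (avoidance P (a :: s) (last a s)) L &
    rho P p (a :: s) = - L.
Proof.
move=> As s_gt0 d_gt0 e_gt0.
move=> /(mean_avoidance_growth_rate d_gt0 e_gt0)[L ML [c c_gt0 c_le]].
set V := avoidance P (a :: s) (last a s).
set M := mean_avoidance P (a :: s) p in ML c_le.
have M_gt0 n : 0 < M n.
  by apply: lt_le_trans (c_le n); rewrite mulr_gt0 ?exprn_gt0 ?expR_gt0.
have [k [q [_ q_lt1 k_le]]] := avoidance_uniform_lt1 AP Airr As; have [_ [_ pP]] := pS.
have [C M_le] : exists C, forall n, M (n + size s)%N <= C * V n.
  eexists => n; rewrite addnC.
  exact: (mean_avoidance_le P_ge0 P_sum1 p_ge0 pP s_gt0 n q_lt1 k_le).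
have V_ge0 n : 0 <= V n by exact: avoidance_ge0.
have V_gt0 n : 0 < V n.
  rewrite lt0r V_ge0 andbT; apply: contraTneq (M_le n) => ->.
  by rewrite mulr0 -ltNge.
have C_gt0 : 0 < C by have := lt_le_trans (M_gt0 _) (M_le 0%N); rewrite pmulr_lgt0.
exists L; last exact: rho_growth_rate.
split=> //.
- exact: mean_avoidance_growth_lt0 As c_gt0 c_le.
- apply: (growth_rate_squeeze (c' := (p 0 (last a s))^-1) M_gt0 V_gt0 M_le _ ML) => n.
  by rewrite ler_pdivlMl // avoidance_le_mean.
- exists (c * expR L ^+ size s / C).
    by rewrite divr_gt0 ?mulr_gt0 ?exprn_gt0 ?expR_gt0.
  move=> n; rewrite mulrAC ler_pdivrMr // -mulrA -exprD addnC [V n * C]mulrC.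
  exact: le_trans (c_le _) (M_le n).
Qed.

Section Comparison.
Variables (a : 'I_N) (v s : seq 'I_N).
Hypothesis eq_size : size s = size v.
Hypothesis eq_last : last a s = last a v.
Hypothesis eq_delta : delta P (a :: s) = delta P (a :: v).
Hypothesis v_gt0 : (0 < size v)%N.
Hypothesis u_prime : prime_word (a :: v).
Hypothesis As : path A a s.
Local Notation U := (avoidance P (a :: v) (last a v)).
Local Notation V := (avoidance P (a :: s) (last a v)).

Lemma prime_avoidance_exponential_decay : path A a v -> s <> v ->
  exists2 L, exponential_decay U L & rho P p (a :: v) = - L.
Proof.
move=> Av sv.
have [e e_gt0 e_le] := prime_word_avoidance_ge AP Airr u_prime eq_size sv As.
apply: (avoidance_exponential_decay (j := a) Av v_gt0 ltr01 e_gt0) => n.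
by rewrite mul1r.
Qed.

Lemma ge_avoidance_exponential_decay Lu : exponential_decay U Lu ->
  exists2 L, exponential_decay V L & rho P p (a :: s) = - L.
Proof.
move=> [_ _ _ [c c_gt0 U_ge]]; rewrite -eq_last.
apply: (avoidance_exponential_decay (j := last a v) As _ c_gt0 (expR_gt0 Lu)) => [|n].
  by rewrite eq_size.
apply: le_trans (U_ge n) _.
exact: (avoidance_le eq_size eq_last eq_delta).
Qed.

Lemma nonprime_exponential_decay_lt Lu Lw : ~ prime_word (a :: s) ->
  exponential_decay U Lu -> exponential_decay V Lw -> Lu < Lw.
Proof.
move=> w_nprime [_ _ _ [c c_gt0 U_ge]] [Lw_lt0 V_gt0 V_rate _].
have [|k k_gt0 corr_gt0] := autocorrelation_nonprime AP As _ w_nprime.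
  by rewrite eq_last prime_word_last_neq.
apply: (renewal_growth_lt (F := first_occurrence P (a :: s) (last a v)))
  Lw_lt0 c_gt0 corr_gt0 U_ge V_gt0 V_rate _ _ _ => [n||n].
- exact: first_occurrence_ge0.
- exact: first_occurrenceE.
- exact: avoidance_gain.
Qed.

End Comparison.

End EscapeRates.

Lemma common_ends (T : eqType) (u w : seq T) : (1 < size u)%N -> size w = size u ->
  take 1 w = take 1 u -> drop (size u).-1 w = drop (size u).-1 u ->
  exists a v s, [/\ u = a :: v, w = a :: s & last a s = last a v].
Proof.
case: u w => [//|a v] [//|c s] _ [eq_size] /=; rewrite !take0 => -[->] eq_drop.
exists a, v, s; split=> //; move: eq_drop.
rewrite {1}lastI {1}[a :: v]lastI -!cats1 -{1}eq_size.
by rewrite !drop_size_cat ?size_belast // => -[].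
Qed.

Theorem theorem5p1 (R : realType) (N : nat) (A : 'I_N -> 'I_N -> bool)
    (P : 'M[R]_N) (p : 'rV[R]_N) (u w : seq 'I_N) :
  irreducible_mx A ->
  compatible_stochastic A P ->
  stationary_vector P p ->
  allowed_word A u -> prime_word u -> (2 <= size u)%N ->
  allowed_word A w -> size w = size u ->
  take 1 w = take 1 u -> drop (size u).-1 w = drop (size u).-1 u ->
  delta P w = delta P u ->
  rho P p w <= rho P p u /\
  ((forall l : R, 0 < l -> eigenvalue P l -> l = 1) ->
     (rho P p w = rho P p u <-> prime_word w)).
Proof.
move=> Airr AP pS Au u_prime u_gt1 Aw eq_size eq_take eq_drop eq_delta.
have [<-|/eqP uw] := eqVneq u w; first by split.
have [a [v [s [uE wE eq_last]]]] := common_ends u_gt1 eq_size eq_take eq_drop.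
subst u w; case: eq_size => eq_size; have v_gt0 : (0 < size v)%N := u_gt1.
have [P_ge0 [P_sum1 _]] := AP.
have [/allowed_word_path Av /allowed_word_path As] := (Au, Aw).
have sv : s <> v by move=> sv; apply: uw; rewrite sv.
have [Lu U_decay ->] :=
  prime_avoidance_exponential_decay Airr AP pS eq_size v_gt0 u_prime As Av sv.
have [Lw V_decay ->] := ge_avoidance_exponential_decay Airr AP pS
  eq_size eq_last eq_delta v_gt0 u_prime As U_decay.
rewrite lerN2; split.
  exact: exponential_decay_le (avoidance_le _ _ _ _ _ _ _) U_decay V_decay.
move=> _; split=> [/oppr_inj LwE|w_prime].
  apply: contrapT => w_nprime; suff : Lu < Lw by rewrite LwE ltxx.
  exact: (nonprime_exponential_decay_lt AP eq_size eq_last eq_delta v_gt0).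
congr (- _); apply: exponential_decay_unique U_decay.
by rewrite -(avoidance_eq_prime eq_size eq_last).
Qed.
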